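(* Let $(T,v^* )$ be an even finite rooted tree with at least one edge, and let $M$ be a positive integer. Let $\phi:V(T)\to\mathbb{Z}$ be a uniformly random $M$-Lipschitz function satisfying $\phi\equiv0$ on the leaves of $T$. Let $R$ be the effective resistance between the root and the leaves of $T$. Then the following hold: (a) $|\phi(v^* )|$ stochastically dominates $\left|\mathcal{N}_{\mathbb{Z}\cap(-R/4,R/4)}\left(0,\frac{R}{64M+32}\right)\right|$; (b) $\mathrm{Var}(\phi(v^* ))\ge\left\lfloor\frac{R}{(64M+32)e^4\sqrt{\pi}}\right\rfloor$; (c) $\mathbb{P}(\phi(v^* )=n)\ge e^{-(32M+16)n^2/R}\cdot\mathbb{P}(\phi(v^* )=0)$ for all integers $-R/4<n<R/4$; (d) $\mathbb{P}(\phi(v^* )=n)\le\frac{e^{32M+16}}{\sqrt{R}}$ for all $n\in\mathbb{Z}$.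
   Context: An integer-valued $M$-Lipschitz function on a graph $G$ is a function $\phi:V(G)\to\mathbb{Z}$ with $|\phi(u)-\phi(v)|\le M$ for every edge $(u,v)$. In a rooted tree, the leaves are the vertices with no children. A rooted tree is even if every leaf is at even distance from the root. The effective resistance is computed in the electrical network in which every edge of $T$ has resistance $1$ and all leaves are identified to a single node. For nonempty $I\subseteq\mathbb{Z}$ and $\sigma^2>0$, $\mathcal{N}_I(0,\sigma^2)$ denotes a discrete Gaussian taking value $x\in I$ with probability proportional to $e^{-x^2/(2\sigma^2)}$. $X$ stochastically dominates $Y$ if $\mathbb{P}(X\ge t)\ge\mathbb{P}(Y\ge t)$ for all $t$. *)

(* Defs.v *)
From HB Require Import structures.
From mathcomp Require Import all_boot all_order all_algebra finmap.
From mathcomp Require Import all_classical all_reals all_analysis.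
From mathcomp Require Import zify.

Set Implicit Arguments.
Unset Strict Implicit.
Unset Printing Implicit Defensive.

Import Order.TTheory GRing.Theory Num.Theory.

Local Open Scope classical_set_scope.
Local Open Scope ring_scope.

Section Trees.
Variables (T : finType) (e : rel T).

(* [ucycle e c] with [size c = 2] just goes back and forth along one edge. *)
Definition tree : Prop :=
  [/\ symmetric e, irreflexive e, forall x y, connect e x y
    & forall c : seq T, ucycle e c -> (size c <= 2)%N].

(* Least number of edges of a walk from x to y; #|T| if there is none. *)
Definition gdist (x y : T) : nat :=
  \big[minn/#|T|]_(n < #|T| |
    [exists p : n.-tuple T, path e x p && (last x p == y)]) (n : nat).

Definition child (r x y : T) : bool := e x y && (gdist r y == (gdist r x).+1).

Definition leaves (r : T) : {set T} := [set x | [forall y, ~~ child r x y]].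

Definition even_tree (r : T) : Prop :=
  forall x, x \in leaves r -> ~~ odd (gdist r x).

Definition lipschitz (M : nat) (phi : T -> int) : Prop :=
  forall u v, e u v -> `|phi u - phi v| <= M%:Z.

Definition lipschitz_vanishing_on (M : nat) (B : {set T}) :
    set {ffun T -> int} :=
  [set phi : {ffun T -> int} |
    lipschitz M phi /\ forall x, x \in B -> phi x = 0].

(* Every edge has resistance 1, so [v x - v y] is the current from x to y.
   Identifying the nodes of B to a single node, which is grounded, means that
   the potential v vanishes on all of B and that Kirchhoff's node law is not
   imposed at the individual nodes of B. *)
Definition unit_current_potential (R : realType) (a : T) (B : {set T})
    (v : T -> R) : Prop :=
  (forall x, x \in B -> v x = 0) /\
  (forall x, x \notin B -> \sum_(y | e x y) (v x - v y) = (x == a)%:R).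

(* Existence and uniqueness of the value are proved below. *)
Definition effective_resistance (R : realType) (a : T) (B : {set T}) : R :=
  xget 0 [set v a | v in unit_current_potential a B].

Lemma exists_leaf (r : T) : exists x, x \in leaves r.
Proof.
case: (@arg_maxnP _ r xpredT (gdist r) isT) => x _ hx; exists x.
rewrite inE; apply/forallP => y; apply/negP => /andP[_ /eqP exy].
have hy : (gdist r y <= gdist r x)%N := hx y isT.
by rewrite exy ltnn in hy.
Qed.

Lemma lipschitz_vanishing_on_finite (M : nat) (B : {set T}) (b : T) :
    (forall x y, connect e x y) -> b \in B ->
  finite_set (lipschitz_vanishing_on M B).
Proof.
move=> econn bB.
have bnd x : exists N : nat, forall phi : {ffun T -> int},
    lipschitz_vanishing_on M B phi -> `|phi x| <= N%:Z.
  have /connectP[p] := econn x b.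
  elim: p x => [|y p IH] x /=.
    move=> _ bx; exists 0%N => phi [_ /(_ b bB)].
    by rewrite bx => ->; rewrite normr0.
  case/andP=> exy yp bl; have [N hN] := IH y yp bl.
  exists (M + N)%N => phi hphi; rewrite -[phi x](subrK (phi y)).
  apply: le_trans (ler_normD _ _) _; rewrite PoszD lerD ?hN//.
  by case: hphi => hl _; exact: hl.
have {bnd} [N hN] := choice bnd.
pose K := (\max_x N x)%N.
pose dec (f : {ffun T -> 'I_(K.*2.+1)}) : {ffun T -> int} :=
  [ffun x => (f x : nat)%:Z - K%:Z].
apply: (@sub_finite_set _ _ (dec @` setT)); last first.
  exact/finite_image/finite_finset.
move=> phi hphi; exists [ffun x => inord (absz (phi x + K%:Z))] => //.
apply/ffunP => x; rewrite !ffunE.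
have := hN x phi hphi; have : (N x <= K)%N by exact: leq_bigmax.
move=> NK hx; rewrite inordK; lia.
Qed.

End Trees.

Section EffectiveResistanceWellDefined.
Variables (T : finType) (e : rel T) (R : realType) (B : {set T}) (b : T).
Hypothesis econn : forall x y, connect e x y.
Hypothesis bB : b \in B.

Lemma maximum_principle (h : T -> R) :
    (forall x, x \in B -> h x = 0) ->
    (forall x, x \notin B -> \sum_(y | e x y) (h x - h y) = 0) ->
  forall x, h x <= 0.
Proof.
move=> hB hN; case: (@arg_maxP _ _ T b xpredT h isT) => m _ hm.
suff hm0 : h m = 0 by move=> x; rewrite -hm0; exact: hm.
have /connectP[p] := econn m b.
suff H : forall x, h x = h m -> path e x p -> b = last x p -> h m = 0.
  by move=> pm bl; exact: (H m).
elim: p => [|y p IH] x hx /=.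
  by move=> _ bx; rewrite -hx -bx hB.
case/andP=> exy yp bl.
have [xB|xB] := boolP (x \in B); first by rewrite -hx hB.
apply: (IH y) => //.
have /eqP := hN x xB; rewrite psumr_eq0 => [|z _]; last first.
  by rewrite hx subr_ge0; exact: hm.
by move=> /allP /(_ y (mem_index_enum y)); rewrite exy subr_eq0 hx => /eqP.
Qed.

Lemma harmonic_eq0 (h : T -> R) :
    (forall x, x \in B -> h x = 0) ->
    (forall x, x \notin B -> \sum_(y | e x y) (h x - h y) = 0) ->
  forall x, h x = 0.
Proof.
move=> hB hN x; apply/eqP; rewrite eq_le maximum_principle//=.
rewrite -oppr_le0; apply: (@maximum_principle (fun x => - h x)) => [y yB|y yB].
  by rewrite hB ?oppr0.
under eq_bigr do rewrite -opprD.
by rewrite sumrN hN ?oppr0.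
Qed.

Lemma unit_current_potential_unique (a : T) (v w : T -> R) :
  unit_current_potential e a B v -> unit_current_potential e a B w -> v =1 w.
Proof.
move=> [vB vN] [wB wN] x; apply/eqP; rewrite -subr_eq0; apply/eqP.
apply: (@harmonic_eq0 (fun x => v x - w x)) => [y yB|y yB].
  by rewrite vB ?wB ?subrr.
transitivity (\sum_(z | e y z) ((v y - v z) - (w y - w z))).
  by apply: eq_bigr => z _; rewrite !opprD !opprK addrACA.
by rewrite sumrB vN ?wN ?subrr.
Qed.

Let lap (v : {ffun T -> R^o}) : {ffun T -> R^o} :=
  [ffun x => if x \in B then v x else \sum_(y | e x y) (v x - v y)].

Let lap_linear : linear lap.
Proof.
move=> k u v; apply/ffunP => x; rewrite !ffunE.
case: ifP => _; rewrite ?ffunE //.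
rewrite scaler_sumr -big_split /=; apply: eq_bigr => y _.
by rewrite !ffunE scalerBr opprD addrACA.
Qed.

HB.instance Definition _ :=
  GRing.isLinear.Build R {ffun T -> R^o} {ffun T -> R^o} _ lap lap_linear.

Lemma unit_current_potential_exists (a : T) :
  exists v : T -> R, unit_current_potential e a B v.
Proof.
have ker0 : lker (linfun lap) == 0%VS.
  rewrite -subv0; apply/subvP => v; rewrite memv_ker lfunE /= memv0 => /eqP v0.
  apply/eqP/ffunP => x; rewrite ffunE; apply: (@harmonic_eq0 v) => y yB.
    by move/ffunP/(_ y): v0; rewrite !ffunE yB.
  by move/ffunP/(_ y): v0; rewrite !ffunE (negbTE yB).
pose g : {ffun T -> R^o} := [ffun x => if x \in B then 0 else (x == a)%:R].
exists ((linfun lap)^-1%VF g).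
have /ffunP lg : lap ((linfun lap)^-1%VF g) = g.
  by rewrite -[LHS]lfunE /= lker0_lfunVK.
by split=> x xB; have := lg x; rewrite !ffunE ?xB ?(negbTE xB).
Qed.

Lemma effective_resistanceE (a : T) (v : T -> R) :
  unit_current_potential e a B v -> effective_resistance e R a B = v a.
Proof.
move=> hv; apply: xget_unique; first by exists v.
by move=> _ [w hw <-]; exact: (unit_current_potential_unique hw hv).
Qed.

End EffectiveResistanceWellDefined.

HB.instance Definition _ := isPointed.Build int 0.
HB.instance Definition _ := @isMeasurable.Build default_measure_display
  int discrete_measurable discrete_measurable0
  discrete_measurableC discrete_measurableU.
HB.instance Definition _ (T : finType) := isPointed.Build {ffun T -> int} 0.
HB.instance Definition _ (T : finType) :=
  @isMeasurable.Build default_measure_display {ffun T -> int}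
    discrete_measurable discrete_measurable0
    discrete_measurableC discrete_measurableU.

Section Laws.
Context d (S : measurableType d) (R : realType).

Definition weight_measure (I : set S) (w : S -> {nonneg R}) (A : set S) :
    \bar R :=
  \esum_(x in A `&` I) (w x)%:num%:E.

Section IsMeasure.
Variables (I : set S) (w : S -> {nonneg R}).

Let weight_measure0 : weight_measure I w set0 = 0%E.
Proof. by rewrite /weight_measure set0I esum_set0. Qed.

Let weight_measure_ge0 A : (0 <= weight_measure I w A)%E.
Proof. by apply: esum_ge0 => x _; rewrite lee_fin. Qed.

Let weight_measure_sigma_additive : semi_sigma_additive (weight_measure I w).
Proof.
move=> F mF tF mUF; apply: cvg_toP.
  by apply: ereal_nondecreasing_is_cvgn => m n mn; exact: lee_sum_nneg_natr.
rewrite /weight_measure setI_bigcupl nneseries_sum_bigcup//.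
exact: trivIset_setIr.
Qed.

HB.instance Definition _ := isMeasure.Build _ _ _ (weight_measure I w)
  weight_measure0 weight_measure_ge0 weight_measure_sigma_additive.

End IsMeasure.

(* The law on I with probabilities proportional to w. The default value
   [\d_point] is used only if the weights sum to 0 or to +oo over I. *)
Definition law_proportional_to (I : set S) (w : S -> {nonneg R}) :
    probability S R :=
  mnormalize (weight_measure I w) \d_(point : S).

Lemma law_proportional_toE (I : set S) (w : S -> {nonneg R}) (A : set S) :
    (0 < \esum_(x in I) (w x)%:num%:E < +oo)%E ->
  law_proportional_to I w A =
  ((\esum_(x in A `&` I) (w x)%:num%:E) *
   (fine (\esum_(x in I) (w x)%:num%:E))^-1%:E)%E.
Proof.
case/andP=> w0 woo; rewrite /law_proportional_to /= /mnormalize /=.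
by rewrite /weight_measure setTI gt_eqF ?lt_eqF.
Qed.

(* Meant for A finite and nonempty. *)
Definition uniform_law (A : set S) : probability S R :=
  law_proportional_to A (fun=> 1%:nng).

Lemma uniform_lawE (A B : set S) : finite_set A -> A !=set0 ->
  uniform_law A B = (#|` fset_set (B `&` A)|%:R / #|` fset_set A|%:R)%:E.
Proof.
move=> finA [a Aa].
have card_esum (C : set S) : finite_set C ->
    (\esum_(x in C) (1%:nng%:num : R)%:E = #|` fset_set C|%:R%:E)%E.
  move=> finC; rewrite esum_fset//= fsbig_finite//= sumEFin.
  by rewrite big_const_seq count_predT iter_addr_0.
have cA : (0 < #|` fset_set A|)%N.
  by rewrite cardfs_gt0; apply/fset0Pn; exists a; rewrite in_fset_set// inE.
rewrite /uniform_law law_proportional_toE.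
  by rewrite !card_esum//; exact: finite_setIr.
by rewrite card_esum// lte_fin ltr0n cA ltry.
Qed.

End Laws.

Definition discrete_gaussian (R : realType) (I : set int) (s2 : R) :
    probability int R :=
  law_proportional_to I (fun x => (expR (- (x%:~R ^+ 2 / (2 * s2))))%:nng).

Definition stochastically_dominates (R : realType)
    d (S : measurableType d) (P : probability S R) (X : S -> R)
    d' (S' : measurableType d') (Q : probability S' R) (Y : S' -> R) : Prop :=
  forall t : R, (Q [set y | (t <= Y y)%R] <= P [set x | (t <= X x)%R])%E.

(* Main.v *)
Require Import Defs.
From HB Require Import structures.
From mathcomp Require Import all_boot all_order all_algebra finmap.
From mathcomp Require Import all_classical all_reals all_analysis.
From mathcomp Require Import measurable_realfun zify ring lra.

(** For a vertex x, let f(n) be the number of Lipschitz functions on the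
    subtree below x that vanish on its leaves and take the value n at x, and
    let S be the resistance between x and these leaves. Then f is even,
    decreasing on the nonnegative integers, and satisfies
    S (f(j) - f(j+1)) <= (j + 1/2) (f(j) + f(j+1)) for j >= 0. Indeed, adding
    an edge above x convolves f with the indicator of [-M, M], after which the
    bound holds with S + 1, and gluing subtrees at a common root multiplies
    their profiles, after which the bound holds with the sum of the
    conductances 1/S. At the root of the tree the bound gives
    f(j+1)/f(j) >= (S - u)/(S + u) with u = j + 1/2, from which the Gaussian
    comparisons follow, and summing it against 2j + 1 by parts gives
    Var >= S/2 - 1/4. The profiles are computed by eliminating the vertices
    one at a time, each being adjacent to a single remaining vertex. *)

Set Implicit Arguments.
Unset Strict Implicit.

Import Order.TTheory GRing.Theory Num.Theory.

Local Open Scope classical_set_scope.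
Local Open Scope ring_scope.

(** * Slope bounds *)

Section Profiles.
Context {R : realFieldType}.
Implicit Types (f g : int -> R) (a b : R) (M : nat).

(* The quotient a / b plays the role of a resistance; a leaf has a = 0. *)
Record slope_bound a b f : Prop := SlopeBound {
  slope_ge0 : forall x, 0 <= f x;
  slope_radial : forall x y : int, `|x| <= `|y| -> f y <= f x;
  slope_le : forall j : int, 0 <= j ->
    2 * a * (f j - f (j + 1)) <= b * (2 * j%:~R + 1) * (f j + f (j + 1)) }.

(** Convolution of f with the indicator of [-M, M]; with centre 0 it also serves as the sum of f
    over [-M, M]. *)
Definition window f (c : int) M : R := \sum_(k < M.*2.+1) f (c - M%:Z + k%:Z).

Lemma window0 f c : window f c 0 = f c.
Proof. by rewrite /window big_ord1; congr f; rewrite /=; lia. Qed.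

Lemma windowS f c M :
  window f c M.+1 = f (c - M.+1%:Z) + window f c M + f (c + M.+1%:Z).
Proof.
rewrite /window doubleS big_ord_recl big_ord_recr /= !addrA.
congr (f _ + _ + f _); [lia | | by rewrite /bump /=; lia].
by apply: eq_bigr => i _; congr f; rewrite /bump /=; lia.
Qed.

Lemma window_diff f c M :
  window f c M - window f (c + 1) M = f (c - M%:Z) - f (c + M%:Z + 1).
Proof.
elim: M => [|M IH]; first by rewrite !window0; congr (f _ - f _); lia.
rewrite !windowS.
rewrite (_ : c + 1 - M.+1%:Z = c - M%:Z); last lia.
rewrite (_ : c + 1 + M.+1%:Z = c + M.+1%:Z + 1); last lia.
rewrite (_ : c + M.+1%:Z = c + M%:Z + 1); last lia.
move: IH; lra.
Qed.

Lemma window_add f c M :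
  window f c M + window f (c + 1) M = window (fun x => f x + f (x + 1)) c M.
Proof.
rewrite /window -big_split /=; apply: eq_bigr => i _; congr (_ + f _); lia.
Qed.

Lemma window_opp f c M : window f (- c) M = window (fun x => f (- x)) c M.
Proof.
rewrite /window (reindex_inj rev_ord_inj) /=; apply: eq_bigr => i _.
by congr f; have := ltn_ord i; lia.
Qed.

Lemma window_le f c M (B : R) :
    (forall x, c - M%:Z <= x <= c + M%:Z -> f x <= B) ->
  window f c M <= (2 * M%:R + 1) * B.
Proof.
move=> H; apply: (@le_trans _ _ (\sum_(k < M.*2.+1) B)).
  by apply: ler_sum => i _; apply: H; have := ltn_ord i; lia.
rewrite sumr_const card_ord -[_ *+ _]mulr_natl -addn1 -muln2 natrD natrM.
lra.
Qed.

Lemma window_radial f c M :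
    (forall x y : int, `|x| <= `|y| -> f y <= f x) -> 0 <= c ->
  window f (c + 1) M <= window f c M.
Proof.
move=> fr c0; rewrite -subr_ge0 window_diff subr_ge0; apply: fr; lia.
Qed.

Lemma slope_opp a b f : slope_bound a b f -> forall x, f (- x) = f x.
Proof.
by case=> _ fr _ x; apply/eqP; rewrite eq_le !fr ?normrN.
Qed.

(** Add the slope bounds at c + i for |i| <= r: the left sides telescope, and the factors 2 c + 1 +
    2 i fall below 2 c + 1 where f is large and exceed it where f is small. For r > 0 this surplus
    pays for raising a to a + b; r <= c keeps the indices nonnegative. *)
Lemma slope_window a b f c r : 0 <= a -> 0 <= b -> slope_bound a b f ->
    (0 < r)%N -> r%:Z <= c ->
  2 * (a + b) * (f (c - r%:Z) - f (c + r%:Z + 1)) <=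
  b * (2 * c%:~R + 1) * window (fun x => f x + f (x + 1)) c r.
Proof.
move=> a0 b0 sf; have fr := slope_radial sf; have fs := slope_le sf.
case: r => // r _; elim: r => [|r IH] rc.
  rewrite windowS window0.
  have := fs (c - 1); have := fs c; have := fs (c + 1).
  have := fr (c - 1) c; have := fr c (c + 1).
  have := fr (c + 1) (c + 1 + 1).
  rewrite !subrK intrD rmorphB /=.
  have -> : f (c - Posz 1) = f (c - 1) by [].
  have -> : f (c + Posz 1 + 1) = f (c + 1 + 1) by [].
  have -> : f (c + Posz 1) = f (c + 1) by [].
  move: (f (c - 1)) (f c) (f (c + 1)) (f (c + 1 + 1)) => p0 p1 p2 p3.
  move=> /(_ ltac:(lia)) h2 /(_ ltac:(lia)) h1 /(_ ltac:(lia)) h0.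
  move=> /(_ ltac:(lia)) g2 /(_ ltac:(lia)) g1 /(_ ltac:(lia)) g0.
  have : 0 <= b * (p1 - p2) by rewrite mulr_ge0 ?subr_ge0.
  lra.
have {IH} := IH ltac:(lia).
rewrite [window _ _ r.+2]windowS /=.
set W := window _ _ _.
have := fs (c - r.+2%:Z); have := fs (c + r.+2%:Z).
have := fr (c - r.+1%:Z) (c + r.+2%:Z).
have := fr (c - r.+2%:Z) (c - r.+1%:Z).
have := fr (c + r.+2%:Z) (c + r.+2%:Z + 1).
rewrite (_ : c - r.+2%:Z + 1 = c - r.+1%:Z); last lia.
rewrite (_ : c + r.+1%:Z + 1 = c + r.+2%:Z); last lia.
rewrite intrD rmorphB /= -[(Posz _)%:~R]pmulrn.
move: (f (c - r.+2%:Z)) (f (c - r.+1%:Z)) => p0 p1.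
move: (f (c + r.+2%:Z)) (f (c + r.+2%:Z + 1)) => q0 q1.
move=> /(_ ltac:(lia)) h2 /(_ ltac:(lia)) h1 /(_ ltac:(lia)) h0.
move=> /(_ ltac:(lia)) g2 /(_ ltac:(lia)) g1 g0.
(* The two new slope bounds save 2 b (r + 2) (p0 + p1 - q0 - q1), while the additional b costs 2 b
   (p0 - p1 + q0 - q1); [k1] and [k2] make up the difference. *)
have k1 : 0 <= b * (p1 - q0) by rewrite mulr_ge0 ?subr_ge0.
have k2 : 0 <= b * r.+1%:R * (p0 + p1 - q0 - q1).
  by rewrite !mulr_ge0//; lra.
rewrite -[r.+2]addn1 natrD in g1 g2.
lra.
Qed.

(** At centre 0 the slope bound at M suffices: each of the 2 M pairs before the last is at least f(M
    - 1) + f(M), and its excess over f(M) + f(M + 1) pays for the additional b. *)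
Lemma slope_window0 a b f M : 0 <= a -> 0 <= b -> slope_bound a b f ->
    (0 < M)%N ->
  2 * (a + b) * (f M%:Z - f (M%:Z + 1)) <=
  b * window (fun x => f x + f (x + 1)) 0 M.
Proof.
move=> a0 b0 sf; have fr := slope_radial sf.
case: M => // M _; rewrite windowS /=.
have := slope_le sf (isT : 0 <= M.+1%:Z); rewrite -[(Posz _)%:~R]pmulrn => h.
have W : (2 * M%:R + 1) * (f M%:Z + f M.+1%:Z) <=
    window (fun x => f x + f (x + 1)) 0 M.
  have := @window_le (fun x => - (f x + f (x + 1))) 0 M
    (- (f M%:Z + f M.+1%:Z)).
  rewrite /window sumrN mulrN lerN2; apply => x hx; rewrite lerN2.
  by apply: lerD; apply: fr; lia.
have h1 : f (0 - M.+1%:Z) = f M.+1%:Z by rewrite sub0r (slope_opp sf).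
have h2 : f (0 - M.+1%:Z + 1) = f M%:Z.
  by rewrite -(slope_opp sf); congr f; lia.
rewrite h1 h2 add0r.
have h3 : f (M.+1%:Z + 1) <= f M.+1%:Z by apply: fr; lia.
have h4 : f M.+1%:Z <= f M%:Z by apply: fr; lia.
rewrite (_ : M.+1%:R = M%:R + 1 :> R) in h; last by rewrite -addn1 natrD.
have := ler_wpM2l b0 W.
have : 0 <= b * (f M%:Z - f M.+1%:Z) by rewrite mulr_ge0 ?subr_ge0.
have : 0 <= b * M%:R * (f M%:Z - f (M.+1%:Z + 1)).
  by rewrite !mulr_ge0 ?subr_ge0//; exact: le_trans h4.
lra.
Qed.

(** The window about M is the right end of the window about n; g is at most B = g(M - n) on it and
    at least B on the rest. The range of y is symmetric about -1/2, as is the function f x + f (x +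
    1) to which this is applied. *)
Lemma window_average g (n M : nat) : (n < M)%N ->
    (forall x y : int, M%:Z - n%:Z <= x -> - x - 1 <= y <= x -> g x <= g y) ->
  (2 * M%:R + 1) * window g M%:Z n <= (2 * n%:R + 1) * window g n%:Z M.
Proof.
move=> nM gr.
pose B := g (M%:Z - n%:Z).
have split_window : window g n%:Z M = \sum_(k < (M - n).*2)
    g (n%:Z - M%:Z + k%:Z) + window g M%:Z n.
  rewrite /window -!(big_mkord xpredT (fun k => g (_ + Posz k))).
  rewrite (@big_cat_nat _ _ _ (M - n).*2) //=; last lia.
  congr (_ + _).
  rewrite -{1}[(M - n).*2]add0n big_addn (_ : _ - _ = n.*2.+1)%N; last lia.
  by apply: eq_bigr => i _; congr g; lia.
have W1 : window g M%:Z n <= (2 * n%:R + 1) * B.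
  by apply: window_le => x hx; apply: gr; lia.
have W2 : 2 * (M - n)%:R * B <= \sum_(k < (M - n).*2) g (n%:Z - M%:Z + k%:Z).
  apply: (@le_trans _ _ (\sum_(k < (M - n).*2) B)); last first.
    by apply: ler_sum => i _; apply: gr => //; have := ltn_ord i; lia.
  by rewrite sumr_const card_ord -muln2 -[B *+ _]mulr_natl natrM [2 * _]mulrC.
rewrite split_window; move: W1 W2; rewrite natrB ?(ltnW nM)//.
set W := window _ _ _; set Q := \sum_(_ < _) _ => W1 W2.
have k1 : 0 <= (M%:R - n%:R : R) by rewrite -natrB ?(ltnW nM).
have k2 : 0 <= 2 * n%:R + 1 :> R by rewrite addr_ge0 ?mulr_ge0.
have h1 := ler_wpM2l k1 W1; have h2 := ler_wpM2l k2 W2.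
lra.
Qed.

(** Series law: a / b becomes a / b + 1. Consecutive windows differ by f(n - M) - f(n + M + 1),
    which [slope_window] bounds if M <= n. For n < M evenness exchanges the roles of M and n, and
    [window_average] exchanges them back. *)
Lemma slope_conv a b f M : 0 <= a -> 0 <= b -> (0 < M)%N ->
  slope_bound a b f -> slope_bound (a + b) b (fun n => window f n M).
Proof.
move=> a0 b0 M0 sf; have fr := slope_radial sf.
have gN x : window f (- x) M = window f x M.
  by rewrite window_opp; apply: eq_bigr => i _; rewrite (slope_opp sf).
have step c : 0 <= c -> window f (c + 1) M <= window f c M.
  exact: window_radial.
split.
- by move=> x; apply: sumr_ge0 => i _; exact: (slope_ge0 sf).
- have abs x : window f x M = window f `|x| M.
    by have [x0|x0] := ger0P x; rewrite ?gN.
  have mono (k l : nat) : window f (k + l)%:Z M <= window f k%:Z M.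
    elim: l => [|l IH]; first by rewrite addn0.
    apply: le_trans IH; rewrite addnS -addn1 PoszD; exact: step.
  move=> x y xy; rewrite (abs x) (abs y).
  have := mono `|x|%N (`|y| - `|x|)%N; rewrite subnKC; last lia.
  by rewrite -!abszE.
- case=> // n _; rewrite window_diff window_add.
  rewrite -[(Posz _)%:~R]pmulrn.
  have [Mn|nM] := leqP M n.
    by have := @slope_window _ _ _ n%:Z _ a0 b0 sf M0; rewrite -[(Posz n)%:~R]pmulrn; apply; lia.
  rewrite (_ : f (n%:Z - M%:Z) = f (M%:Z - n%:Z)); last first.
    by rewrite -(slope_opp sf) opprB.
  (* The terms of opposite index cancel, which leaves the window of centre M
     and radius n. *)
  have [->|n0] := posnP n.
    rewrite subr0 add0r mulr0 add0r mulr1; exact: slope_window0.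
  have := @slope_window _ _ _ M%:Z _ a0 b0 sf n0.
  rewrite -[(Posz M)%:~R]pmulrn [n%:Z + _]addrC => h; apply: (le_trans (h _)).
    lia.
  rewrite -!mulrA; apply: ler_wpM2l => //.
  apply: window_average => // x y hx hy.
  have [y0|y0] := lerP 0 y; first by apply: lerD; apply: fr; lia.
  by rewrite addrC; apply: lerD; apply: fr; lia.
Qed.

Lemma slope_scale a b (c : R) f : 0 <= c -> slope_bound a b f ->
  slope_bound (c * a) (c * b) f.
Proof.
move=> c0 [f0 fr fs]; split => // j j0.
have := ler_wpM2l c0 (fs j j0); lra.
Qed.

(** Parallel law: conductances add. With x = b (2 j + 1) and y = c (2 j + 1) the hypotheses read A
    (2 - x) <= A' (2 + x) and B (2 - y) <= B' (2 + y). If x + y < 2, multiply them and use (2 + x)(2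
    + y) / ((2 - x)(2 - y)) <= (2 + x + y) / (2 - x - y), the superadditivity of artanh. *)
Lemma slope_mul b (c : R) f g : 0 <= b -> 0 <= c ->
    slope_bound 1 b f -> slope_bound 1 c g ->
  slope_bound 1 (b + c) (fun n => f n * g n).
Proof.
move=> b0 c0 [f0 fr fs] [g0 gr gs]; split.
- by move=> x; rewrite mulr_ge0.
- by move=> x y xy; rewrite ler_pM ?fr ?gr.
move=> j j0 /=; have := fs j j0; have := gs j j0.
have : f (j + 1) <= f j by apply: fr; lia.
have : g (j + 1) <= g j by apply: gr; lia.
have := f0 j; have := f0 (j + 1); have := g0 j; have := g0 (j + 1).
move: (f j) (f (j + 1)) (g j) (g (j + 1)) => A A' B B' B'0 B0 A'0 A0 BB' AA'.
have t0 : 0 <= 2 * j%:~R + 1 :> R by rewrite addr_ge0 ?mulr_ge0 ?ler0z.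
have : 0 <= b * (2 * j%:~R + 1) by rewrite mulr_ge0.
have : 0 <= c * (2 * j%:~R + 1) by rewrite mulr_ge0.
rewrite [(b + c) * _]mulrDl; move: (b * _) (c * _) => x y y0 x0 hg hf.
have hA : A * (2 - x) <= A' * (2 + x) by lra.
have hB : B * (2 - y) <= B' * (2 + y) by lra.
suff : A * B * (2 - (x + y)) <= A' * B' * (2 + (x + y)) by lra.
have [xy|xy] := lerP 2 (x + y).
  apply: (@le_trans _ _ 0); first by apply: mulr_ge0_le0; [exact: mulr_ge0 | lra].
  by apply: mulr_ge0; [exact: mulr_ge0 | lra].
have h1 : A * B * ((2 - x) * (2 - y)) <= A' * B' * ((2 + x) * (2 + y)).
  rewrite mulrACA [X in _ <= X]mulrACA; apply: ler_pM => //.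
  by apply: mulr_ge0; lra.
  by apply: mulr_ge0; lra.
have h2 : (2 - (x + y)) * ((2 + x) * (2 + y)) <=
          (2 + (x + y)) * ((2 - x) * (2 - y)).
  have : 0 <= x * y * (x + y) by rewrite !mulr_ge0// addr_ge0.
  lra.
have p0 : 0 < (2 + x) * (2 + y) by apply: mulr_gt0; lra.
rewrite -(ler_pM2r p0).
have AB0 : 0 <= A * B by rewrite mulr_ge0.
have q0 : 0 <= 2 + (x + y) by lra.
have := ler_wpM2l AB0 h2; have := ler_wpM2l q0 h1; lra.
Qed.

End Profiles.

(** * Elimination of the vertices of a tree *)

Section EliminationOrders.
Variables (T : finType) (e : rel T) (r : T).
Implicit Types (x y z : T) (V : seq T).

(** The head is always a leaf of the tree that remains, p being its only neighbour there, so
    induction over the tree becomes induction over this list. *)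
Inductive elimination_order : seq T -> Prop :=
| elimination_root : elimination_order [:: r]
| elimination_leaf x p V : elimination_order V -> x \notin V ->
    [seq y <- V | e x y] = [:: p] -> elimination_order (x :: V).

Lemma elimination_uniq V : elimination_order V -> uniq V.
Proof. by elim=> //= x p V' _ -> ->. Qed.

Lemma mem_elimination_root V : elimination_order V -> r \in V.
Proof.
elim=> [|x p V' _ rV _ _]; first by rewrite inE.
by rewrite inE rV orbT.
Qed.

Lemma neighborP x p V : [seq y <- V | e x y] = [:: p] ->
  forall y, (y \in V) && e x y = (y == p).
Proof. by move=> xp y; rewrite andbC -mem_filter xp inE. Qed.

(** Follow the neighbours p down to r. The relation is confined to V so that a vertex outside V can
    close such a walk to a cycle. *)
Lemma elimination_connect V y : elimination_order V -> y \in V ->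
  connect [rel u v | [&& e u v, u \in V & v \in V]] y r.
Proof.
move=> eoV; elim: eoV y => [|x p V' _ IH _ xp] y.
  by rewrite inE => /eqP->; exact: connect0.
have sub z : z \in V' ->
    connect [rel u v | [&& e u v, u \in x :: V' & v \in x :: V']] z r.
  move=> /IH; apply: connect_sub => u v /= /and3P[uv uV vV].
  by apply: connect1; rewrite /= uv !inE uV vV !orbT.
rewrite inE => /predU1P[->|]; last exact: sub.
have /andP[pV xp'] : (p \in V') && e x p by rewrite (neighborP xp).
apply: connect_trans (sub p pV).
by apply: connect1; rewrite /= xp' !inE eqxx pV !orbT.
Qed.

Lemma connect_exit (P : pred T) x y : P x -> ~~ P y -> connect e x y ->
  exists u v, [/\ P u, ~~ P v & e u v].
Proof.
move=> Px + /connectP[p]; elim: p x Px => [|z p IH] x Px nPy /=.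
  by move=> _ yx; rewrite yx Px in nPy.
case/andP=> xz zp yz; have [Pz|nPz] := boolP (P z); first exact: (IH z).
by exists x, z.
Qed.

Hypothesis treeT : tree e.

(** If y and z differed, a simple path between them inside V, closed through x, would be a cycle of
    length at least 3. *)
Lemma tree_unique_neighbor V x y z : elimination_order V -> x \notin V ->
  y \in V -> z \in V -> e x y -> e x z -> y = z.
Proof.
case: treeT => es _ _ ec eoV xV yV zV xy xz; apply/eqP/negPn/negP => yz.
pose e' := [rel u v | [&& e u v, u \in V & v \in V]].
have e's : symmetric e' by move=> u v /=; rewrite es [(_ \in _) && _]andbC.
have : connect e' y z.
  apply: connect_trans (elimination_connect eoV yV) _.
  by rewrite (sym_connect_sym e's); exact: elimination_connect.
case/connectP=> p0 /shortenP[p yp up _] zl.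
have pV : all (mem V) (y :: p).
  rewrite /= yV; elim: p y yp {up zl xy yz yV} => //= w p IH u.
  by case/andP=> /and3P[_ _ wV] /IH ->; rewrite wV.
have ep : path e y p by apply: sub_path yp => u v /= /and3P[].
have : ucycle e (x :: y :: p).
  apply/andP; split.
    by rewrite /cycle rcons_path /= xy ep -zl es.
  rewrite cons_uniq up andbT; apply/negP => /(allP pV) /=; exact/negP.
move/ec; case: p {yp up pV ep} zl => //= zy.
by rewrite zy eqxx in yz.
Qed.

Lemma tree_elimination_order :
  exists2 V, elimination_order V & forall x, x \in V.
Proof.
have [es _ econn _] := treeT.
(* Starting from r, an edge leaving V supplies the next vertex to prepend; a duplicate-free list has
   at most #|T| entries, so the process ends with all of T. *)
suff H k : exists2 V, elimination_order V &
    (k < size V)%N \/ forall x, x \in V.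
  have [V eoV [hV|hV]] := H #|T|; last by exists V.
  exists V => // x; have := uniq_leq_size (elimination_uniq eoV)
    (s2 := enum T) (fun y _ => mem_enum T y).
  by rewrite -cardE leqNgt hV.
elim: k => [|k [V eoV [hV|hV]]]; last by exists V => //; right.
  by exists [:: r]; [exact: elimination_root | left].
have [VT|] := boolP [forall x, x \in V].
  by exists V => //; right; exact/forallP.
case/forallPn=> z zV.
have [u [x [uV xV ux]]] :=
  connect_exit (P := mem V) (mem_elimination_root eoV) zV (econn r z).
exists (x :: V); last by left.
apply: (@elimination_leaf x u) => //.
have : uniq [seq y <- V | e x y] by rewrite filter_uniq// elimination_uniq.
have : u \in [seq y <- V | e x y] by rewrite mem_filter es ux.
have : {subset [seq y <- V | e x y] <= [:: u]}.
  move=> y; rewrite mem_filter inE => /andP[xy yV]; apply/eqP.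
  by apply: (tree_unique_neighbor eoV xV) => //; rewrite es.
move=> sub um us; apply: perm_small_eq => //; apply: uniq_perm => // y.
by apply/idP/idP => [/sub//|]; rewrite inE => /eqP->.
Qed.

End EliminationOrders.

(** * Counting Lipschitz functions by vertex elimination *)

Section LipschitzCount.
Variables (R : realFieldType) (T : finType) (e : rel T) (r : T) (M : nat).
Implicit Types (x y z : T) (V : seq T) (phi : {ffun T -> int}) (n : int).
Hypotheses (esym : symmetric e) (eirr : irreflexive e).

Definition lipschitz_on V phi : Prop :=
  forall u v, u \in V -> v \in V -> e u v -> `|phi u - phi v| <= M%:Z.

Definition extend phi x n : {ffun T -> int} :=
  [ffun z => if z == x then n else phi z].

(** A function on V is represented by its extension by 0, so that it is listed once. The boundary
    condition enters later, through the weights. *)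
Definition enumerates V n (s : seq {ffun T -> int}) : Prop :=
  uniq s /\ forall phi, phi \in s <->
    [/\ phi r = n, lipschitz_on V phi & forall z, z \notin V -> phi z = 0].

Lemma enumerates_root n :
  enumerates [:: r] n [:: [ffun z => if z == r then n else 0]].
Proof.
split=> // phi; rewrite inE; split.
  move=> /eqP->; split; first by rewrite ffunE eqxx.
    by move=> u v; rewrite !inE => /eqP-> /eqP->; rewrite eirr.
  by move=> z; rewrite inE ffunE => /negbTE->.
case=> phir _ phi0; apply/eqP/ffunP => z; rewrite ffunE.
by case: eqP => [->//|/eqP zr]; apply: phi0; rewrite inE.
Qed.

Definition extensions x p s : seq {ffun T -> int} :=
  [seq extend phi x (phi p - M%:Z + k%:Z) | phi <- s, k <- iota 0 M.*2.+1].

(** Since p is the only neighbour of x in V, the value at x is constrained only to lie within M of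
    the value at p. *)
Lemma enumerates_leaf x p V n s : r \in V -> x \notin V ->
    [seq y <- V | e x y] = [:: p] -> enumerates V n s ->
  enumerates (x :: V) n (extensions x p s).
Proof.
move=> rV xV xp [us sP].
have /andP[pV xep] : (p \in V) && e x p by rewrite (neighborP xp).
have ext_on phi m z : z \in V -> extend phi x m z = phi z.
  by move=> zV; rewrite ffunE; case: eqP zV xV => // -> ->.
have ext_x phi m : extend phi x m x = m by rewrite ffunE eqxx.
split.
  apply: allpairs_uniq; [exact: us | exact: iota_uniq |].
  move=> i j /allpairsP[[phi k] [phis _ ->]].
  case/allpairsP=> [[psi l] [psis _ ->]] /= E.
  rewrite /= in phis psis.
  have /sP[_ _ phi0] := phis; have /sP[_ _ psi0] := psis.
  have {psis phis} phipsi : phi = psi.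
    apply/ffunP => z; have [->|zx] := eqVneq z x; first by rewrite phi0 ?psi0.
    by have /ffunP/(_ z) := E; rewrite !ffunE (negbTE zx).
  rewrite -phipsi in E *; congr (_, _).
  by have /ffunP/(_ x) := E; rewrite !ext_x; lia.
move=> phi; split.
  case/allpairsP=> [[psi k] [/sP[psir psiV psi0]]].
  rewrite mem_iota /= => hk ->; split.
  - by rewrite ext_on.
  - move=> u v; rewrite !inE => /predU1P[->|uV] /predU1P[->|vV].
    + by rewrite eirr.
    + move=> xv; have /eqP-> : v == p by rewrite -(neighborP xp) vV.
      by rewrite ext_x ext_on//; lia.
    + rewrite esym => xu; have /eqP-> : u == p by rewrite -(neighborP xp) uV.
      by rewrite ext_x ext_on//; lia.
    + by rewrite !ext_on//; exact: psiV.
  - by move=> z; rewrite inE negb_or ffunE => /andP[/negbTE-> /psi0].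
case=> phir phiV phi0; apply/allpairsP.
have := phiV x p; rewrite !inE eqxx pV orbT => /(_ isT isT xep) hxp.
(* The preimage resets the value at x to 0 and records its position in the window about [phi p]. *)
exists (extend phi x 0, absz (phi x - phi p + M%:Z)); split.
- apply/sP; split; first by rewrite ext_on.
    by move=> u v uV vV uv; rewrite !ext_on// phiV// inE ?uV ?vV orbT.
  move=> z zV; rewrite ffunE; case: eqP => // /eqP zx.
  by rewrite phi0// inE negb_or zx.
- by rewrite mem_iota /=; lia.
apply/ffunP => z; rewrite ffunE; case: eqP => [->|/eqP zx].
  by rewrite /= ext_on//; lia.
by rewrite ffunE (negbTE zx).
Qed.

Definition weight V (F : T -> int -> R) phi : R := \prod_(z <- V) F z (phi z).

(** The profiles after summing over the value at x: only p feels the sum, through the convolved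
    profile of x. *)
Definition absorb x p (F : T -> int -> R) z n : R :=
  if z == p then window (F x) n M * F p n else F z n.

Lemma sum_weight_leaf x p V n s F : uniq V -> x \notin V ->
    [seq y <- V | e x y] = [:: p] ->
  \sum_(phi <- extensions x p s) weight (x :: V) F phi =
  \sum_(phi <- s) weight V (absorb x p F) phi.
Proof.
move=> uV xV xp.
have /andP[pV xep] : (p \in V) && e x p by rewrite (neighborP xp).
rewrite big_allpairs_dep; apply: eq_bigr => phi _.
transitivity (window (F x) (phi p) M * weight V F phi).
  rewrite /window mulr_suml -(big_mkord xpredT
    (fun k => F x (phi p - M%:Z + k%:Z) * weight V F phi)) /index_iota subn0.
  apply: eq_bigr => k _; rewrite /weight big_cons ffunE eqxx; congr (_ * _).
  apply: eq_big_seq => z zV; rewrite ffunE.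
  by case: eqP zV xV => // -> ->.
rewrite /weight !(bigD1_seq p)//= /absorb eqxx mulrA; congr (_ * _).
by apply: eq_bigr => z /negbTE->.
Qed.

Variable B : {set T}.
Variable v : T -> R.
Hypothesis vB : forall x, x \in B -> v x = 0.

Let interior x : R := (x \notin B)%:R.

(* The network obtained from the subgraph on V by connecting each z to the
   ground through a resistor of conductance [k z]: Kirchhoff's law for v is
   imposed only off B, and at z the profile [F z] has slope bound given by
   [k z]. *)
Definition grounded_network V (F : T -> int -> R) (k : T -> R) : Prop :=
  forall z, z \in V ->
    [/\ 0 <= k z, 0 < interior z + k z, slope_bound (interior z) (k z) (F z)
      & interior z * ((z == r)%:R - \sum_(w <- V | e z w) (v z - v w)) =
        v z * k z].

(** Network reduction: the unit edge from p to x, in series with [k x], becomes a conductance from p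
    to the ground, in parallel with [k p]. The profiles follow by [slope_conv] and [slope_mul], and
    v still satisfies Kirchhoff's law on V. *)
Lemma grounded_network_leaf x p V F k : r \in V -> x \notin V -> uniq V ->
    [seq y <- V | e x y] = [:: p] -> (0 < M)%N ->
    grounded_network (x :: V) F k ->
  grounded_network V (absorb x p F)
    (fun z => if z == p then k x / (interior x + k x) + k p else k z).
Proof.
move=> rV xV uV xp M0 net.
have /andP[pV xep] : (p \in V) && e x p by rewrite (neighborP xp).
have xr : x == r = false by apply: contraNF xV => /eqP->.
have [k0 ak0 sx Kx] := net x (mem_head x V).
have int0 z : 0 <= interior z by rewrite ler0n.
(* The replacement carries the same current out of p as the removed edge did. *)
have Kx' : v p * (k x / (interior x + k x)) = v p - v x.
  have akN : interior x + k x != 0 by rewrite gt_eqF.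
  move: Kx; rewrite xr big_cons eirr -big_filter xp big_seq1 => Kx.
  apply: (mulIf akN); rewrite mulrA mulfVK//.
  by move: Kx => /=; lra.
have sx' : slope_bound 1 (k x / (interior x + k x))
    (fun n => window (F x) n M).
  have cinv : 0 <= (interior x + k x)^-1 by rewrite invr_ge0 ltW.
  have := slope_scale cinv (slope_conv (int0 x) k0 M0 sx).
  by rewrite mulVf ?gt_eqF// [_^-1 * k x]mulrC.
have c0 : 0 <= k x / (interior x + k x) by rewrite divr_ge0// ltW.
move=> z zV; have zV' : z \in x :: V by rewrite inE zV orbT.
have [kz0 akz0 sz Kz] := net z zV'.
have zx : z == x = false by apply: contraNF xV => /eqP<-.
rewrite /absorb {zV'}; case: (eqVneq z p) => [zp|zp].
  rewrite {z}zp in kz0 akz0 sz Kz zV zx *.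
  split.
  - exact: addr_ge0.
  - by rewrite addrCA ltr_wpDl.
  - move: sz; rewrite /interior; case: (p \notin B) => sz.
      exact: slope_mul.
    (* At a grounded p the left side of the slope bound is 0, so nonnegativity and monotonicity of
       the product are enough. *)
    have [w0 wr _] := sx'; have [f0 fr _] := sz.
    split=> [y|y y' yy'|j j0]; first by rewrite mulr_ge0.
      by rewrite ler_pM ?wr ?fr.
    by rewrite mulr0 mul0r !mulr_ge0 ?addr_ge0// ?mulr_ge0 ?ler0z.
  - rewrite /interior; have [pB|pB] := boolP (p \in B).
      by rewrite vB// !mul0r.
    move: Kz; rewrite big_cons esym xep [v p * (_ + _)]mulrDr Kx'.
    by rewrite /interior pB /=; lra.
split=> //.
move: Kz; rewrite big_cons.
suff -> : e z x = false by [].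
by apply: contraNF zp => ezx; rewrite -(neighborP xp) zV esym.
Qed.

(** When only r is left, Kirchhoff's law for the unit current reads interior r = v r c, so c is the
    inverse of the resistance if r is not grounded. The lists are chosen before F and k because the
    induction changes both. *)
Theorem slope_bound_sum_weight V : (0 < M)%N -> elimination_order e r V ->
  exists2 s : int -> seq {ffun T -> int}, forall n, enumerates V n (s n) &
  forall F k, grounded_network V F k ->
    exists2 c, 0 <= c & interior r = v r * c /\
      slope_bound (interior r) c (fun n => \sum_(phi <- s n) weight V F phi).
Proof.
move=> M0; elim=> [|x p V' eoV [s sP IH] xV xp].
  exists (fun n => [:: [ffun z => if z == r then n else 0]]).
    exact: enumerates_root.
  move=> F k net; have [k0 _ sr Kr] := net r (mem_head r _).
  exists (k r) => //; split.
    by rewrite -Kr big_mkcond big_seq1 eirr subr0 eqxx mulr1.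
  rewrite (_ : (fun n => _) = F r)//.
  by apply/funext => n; rewrite big_seq1 /weight big_seq1 ffunE eqxx.
have rV := mem_elimination_root eoV; have uV := elimination_uniq eoV.
exists (fun n => extensions x p (s n)).
  by move=> n; exact: enumerates_leaf.
move=> F k net.
have [c c0 [Kc sc]] := IH _ _ (grounded_network_leaf rV xV uV xp M0 net).
exists c => //; split=> //.
by under eq_fun do rewrite sum_weight_leaf//.
Qed.

End LipschitzCount.

(** * The profile at the root *)

Section RootProfile.
Variables (R : realType) (T : finType) (e : rel T) (r : T) (M : nat).
Hypotheses (treeT : tree e) (edgeT : exists x y, e x y) (M_gt0 : (0 < M)%N).

Lemma gdist_le x (p : seq T) : (size p < #|T|)%N -> path e x p ->
  (gdist e x (last x p) <= size p)%N.
Proof.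
move=> pT xp; rewrite /gdist -minEnat.
apply: (@bigmin_le_cond _ nat _ _ (Ordinal pT) _ (@nat_of_ord _)).
by apply/existsP; exists (in_tuple p); rewrite /= xp eqxx.
Qed.

Lemma root_notin_leaves : r \notin leaves e r.
Proof.
have [es eirr econn _] := treeT.
have [y ery] : exists y, e r y.
  have [x [y xy]] := edgeT.
  have /connectP[[|z p] /= rp xl] := econn r x; first by exists y; rewrite -xl.
  by case/andP: rp => rz _; exists z.
have ry : r != y by apply: contraTneq ery => <-; rewrite eirr.
rewrite inE negb_forall; apply/existsP; exists y; rewrite negbK /child ery /=.
(* [gdist] only ranges over lengths below #|T|, so walks of length 1 are seen once #|T| > 1. *)
have T1 : (1 < #|T|)%N.
  by rewrite (cardD1 r) (cardD1 y) !inE eq_sym ry.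
have T0 : (0 < #|T|)%N by exact: ltn_trans T1.
have r0 : gdist e r r = 0%N.
  by apply/eqP; rewrite -leqn0; exact: (@gdist_le r [::]).
rewrite r0 eqn_leq; apply/andP; split.
  by apply: (@gdist_le r [:: y]) => //=; rewrite ery.
rewrite /gdist; elim/big_ind: _ => [//|a b a0 b0|[[|n] //= nT]].
  by rewrite leq_min a0.
by case/existsP=> p; rewrite tuple0 /= (negbTE ry).
Qed.

Definition root_count (n : int) : R :=
  #|` fset_set ([set phi : {ffun T -> int} | phi r = n] `&`
     lipschitz_vanishing_on e M (leaves e r))|%:R.

Lemma finite_lipschitz : finite_set (lipschitz_vanishing_on e M (leaves e r)).
Proof.
have [_ _ econn _] := treeT; have [b bL] := exists_leaf e r.
exact: lipschitz_vanishing_on_finite bL.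
Qed.

Lemma slope_bound_root_count :
  0 < effective_resistance e R r (leaves e r) /\
  slope_bound (effective_resistance e R r (leaves e r)) 1 root_count.
Proof.
have [es eirr econn _] := treeT; have [b bL] := exists_leaf e r.
have [v hv] := unit_current_potential_exists R econn bL r.
rewrite (effective_resistanceE econn bL hv); have [vL vK] := hv.
have [V eoV VT] := tree_elimination_order r treeT.
have [s sP IH] := @slope_bound_sum_weight R T e r M es eirr _ _ vL _ M_gt0 eoV.
(* Leaves are grounded and may only take the value 0; the other vertices start with conductance 0
   and a constant profile. The weight is then the indicator of vanishing on the leaves. *)
pose F z (n : int) : R := if z \in leaves e r then (n == 0)%:R else 1.
have [|c c0 [vc sc]] := IH F (fun z => (z \in leaves e r)%:R).
  move=> z _; split.
  - exact: ler0n.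
  - by case: (z \in leaves e r); rewrite /= ?addr0 ?add0r ltr01.
  - rewrite /F; case: (z \in leaves e r) => /=; split.
    + by move=> x; exact: ler0n.
    + by move=> x y xy; rewrite ler_nat; move: xy; lia.
    + move=> j j0; rewrite mulr0 mul0r mul1r mulr_ge0 ?addr_ge0 ?ler0n//.
      by rewrite mulr_ge0 ?ler0z.
    + by [].
    + by [].
    + by move=> j j0; rewrite subrr mulr0 !mul0r.
  - have [zL|zL] := boolP (z \in leaves e r).
      by rewrite vL// !mul0r.
    rewrite /= mulr0 mul1r -(vK z zL); apply/eqP; rewrite subr_eq0; apply/eqP.
    apply: perm_big; apply: uniq_perm; rewrite ?index_enum_uniq//.
      exact: elimination_uniq eoV.
    by move=> x; rewrite mem_index_enum VT.
have cE n : \sum_(phi <- s n) weight V F phi = root_count n.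
  pose van (phi : {ffun T -> int}) := [forall z in leaves e r, phi z == 0].
  have wE phi : weight V F phi = (van phi)%:R.
    have [phi0|phi0] := boolP (van phi).
      apply: big1 => z _; rewrite /F; case: ifP => // zL.
      by rewrite (eqP (forall_inP phi0 z zL)).
    have /forall_inPn[z zL zphi] := phi0.
    rewrite /weight (bigD1_seq z)//= ?(elimination_uniq eoV)//.
    by rewrite /F zL (negbTE zphi) mul0r.
  transitivity ((count van (s n))%:R : R).
    rewrite -sum1_count [in RHS]big_mkcond natr_sum; apply: eq_bigr => phi _.
    by rewrite wE; case: (van phi).
  congr (_%:R); rewrite -size_filter; apply: perm_size; apply: uniq_perm.
  - by rewrite filter_uniq//; case: (sP n).
  - exact: fset_uniq.
  move=> phi; rewrite mem_filter.
  have finA : finite_set ([set phi : {ffun T -> int} | phi r = n] `&`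
      lipschitz_vanishing_on e M (leaves e r)).
    by apply: finite_setIr; exact: finite_lipschitz.
  rewrite in_fset_set//; have [_ /(_ phi) sPn] := sP n.
  apply/andP/idP => [[/forall_inP phi0 /sPn[phir phiV _]]|].
    rewrite inE; split=> //; split=> [u w uw|z /phi0 /eqP//].
    exact: phiV.
  rewrite inE => -[phir [phiV phi0]]; split.
    by apply/forall_inP => z /phi0 ->.
  apply/sPn; split=> // [u w _ _|z]; first exact: phiV.
  by rewrite VT.
move: vc sc; rewrite root_notin_leaves /= => vc sc.
have v0 : 0 < v r.
  have c1 : 0 < c.
    rewrite lt_def c0 andbT; apply/eqP => c1.
    by move/eqP: vc; rewrite c1 mulr0 oner_eq0.
  by rewrite -(pmulr_lgt0 _ c1) -vc.
(* Since v r c = 1, scaling by v r turns the pair (1, c) into (v r, 1). *)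
split=> //; have := slope_scale (ltW v0) sc; rewrite mulr1 -vc.
by under eq_fun do rewrite cE.
Qed.

End RootProfile.

(** * Comparison with Gaussian weights *)

Section GaussianComparison.
Variables (R : realType) (S : R) (N : int -> R).
Hypotheses (S_gt0 : 0 < S) (slopeN : slope_bound S 1 N).

Lemma slope_abs (n : int) : N n = N (absz n).
Proof.
by case: n => // n; rewrite NegzE (slope_opp slopeN).
Qed.

Definition gaussian_weight (c : R) (x : R) : R := expR (- (c * x ^+ 2 / S)).

Lemma gaussian_weight_gt0 c x : 0 < gaussian_weight c x.
Proof. exact: expR_gt0. Qed.

(* (1 - t) / (1 + t) >= exp (-4 t) for 0 <= t <= 1/2, where
   t = (2 j + 1) / (2 S). *)
Lemma slope_gaussian_step c (j : nat) : 2 <= c -> j.+1%:R < S / 4 ->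
  N j <= N j.+1 * expR (c * (2 * j%:R + 1) / S).
Proof.
move=> c2 jS; pose t := (2 * j%:R + 1) / S.
have t0 : 0 <= t by rewrite divr_ge0 ?ltW// addr_ge0 ?mulr_ge0.
have j0 : 0 <= j%:R :> R by [].
have t1 : t <= 1 / 2.
  by rewrite ler_pdivrMr//; move: jS; rewrite -addn1 natrD; lra.
have := slope_le slopeN (isT : 0 <= Posz j).
rewrite -[(Posz _)%:~R]pmulrn mul1r.
rewrite (_ : Posz j + 1 = Posz j.+1); last by lia.
have Nj := slope_ge0 slopeN (Posz j.+1).
have := slope_ge0 slopeN (Posz j).
move: (N j) (N j.+1) Nj => A B B0 A0 h.
have {}h : 2 * (A - B) <= t * (A + B).
  by rewrite /t mulrAC ler_pdivlMr//; lra.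
have : A <= B * (1 + 2 * t).
  have h0 : 0 <= B * t * (1 / 2 - t) by apply: mulr_ge0; [exact: mulr_ge0 | lra].
  have h1 : 0 <= B * t by exact: mulr_ge0.
  have h2 : 0 < 2 - t by lra.
  by rewrite -(ler_pM2r h2); lra.
move=> /le_trans; apply; apply: ler_wpM2l => //.
rewrite -mulrA; apply: le_trans (expR_ge1Dx _); rewrite -/t lerD2l.
exact: ler_wpM2r.
Qed.

(** The ratio of N to the Gaussian weight is nondecreasing in the absolute value below S / 4: one
    step from k to k + 1 costs the exponent (k + 1)^2 - k^2 = 2 k + 1. *)
Lemma slope_gaussian c (x y : int) : 2 <= c -> `|x| <= `|y| ->
    `|y|%:~R < S / 4 ->
  gaussian_weight c y%:~R * N x <= gaussian_weight c x%:~R * N y.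
Proof.
move=> c2 xy yS.
have gabs (z : int) : gaussian_weight c z%:~R = gaussian_weight c (absz z)%:R.
  rewrite /gaussian_weight -[X in expR (- (_ * X / _))]real_normK ?num_real//.
  by rewrite -intr_norm -abszE -[(Posz _)%:~R]pmulrn.
rewrite !gabs (slope_abs x) (slope_abs y).
have {}xy : (absz x <= absz y)%N by lia.
move: yS; rewrite -abszE -[(Posz _)%:~R]pmulrn.
move: (absz x) (absz y) xy => j k; elim: k => [|k IH].
  by rewrite leqn0 => /eqP->.
rewrite leq_eqVlt => /predU1P[->//|]; rewrite ltnS => jk kS.
have gk : gaussian_weight c k%:R =
    gaussian_weight c k.+1%:R * expR (c * (2 * k%:R + 1) / S).
  rewrite /gaussian_weight -expRD -addn1 natrD; congr expR; field.
  by rewrite gt_eqF.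
have h1 := slope_gaussian_step c2 kS.
have {IH} := IH jk (le_lt_trans _ kS); rewrite ler_nat leqnSn => /(_ isT).
rewrite {}gk => h2.
set E := expR _ in h1 h2.
have E0 : 0 < E by exact: expR_gt0.
rewrite -(ler_pM2r E0) mulrAC; apply: (le_trans h2).
by rewrite -[X in _ <= X]mulrA; apply: ler_wpM2l => //; exact/ltW/expR_gt0.
Qed.

Lemma window_mono (f : int -> R) (m K : nat) : (forall x, 0 <= f x) ->
  (m <= K)%N -> window f 0 m <= window f 0 K.
Proof.
move=> f0; elim: K => [|K IH]; first by rewrite leqn0 => /eqP->.
rewrite leq_eqVlt => /predU1P[->//|]; rewrite ltnS => /IH h.
by rewrite windowS; have := f0 (0 - K.+1%:Z); have := f0 (0 + K.+1%:Z); lra.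
Qed.

(* Summation by parts: multiply the slope bound at j by 2 j + 1. *)
Lemma slope_second_moment (K : nat) : (forall n, K%:Z < `|n| -> N n = 0) ->
  2 * S * window N 0 K <=
  window N 0 K + 4 * window (fun n => n%:~R ^+ 2 * N n) 0 K.
Proof.
move=> NK.
(* Partial sums leave boundary terms at m + 1, which vanish for m = K. *)
have H m : 2 * S * (window N 0 m - (2 * m%:R + 1) * N m.+1) <=
    window N 0 m + 4 * window (fun n => n%:~R ^+ 2 * N n) 0 m +
    (2 * m%:R + 1) ^+ 2 * N m.+1.
  elim: m => [|m IH].
    have := slope_le slopeN (isT : 0 <= Posz 0).
    rewrite !window0 /= (_ : Posz 0 + 1 = 1%:Z)//.
    move: (N 0) (N 1) => p q; rewrite !mulr0 !add0r expr0n expr1n /=; lra.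
  rewrite !windowS !add0r /= mulrNz sqrrN (slope_opp slopeN).
  rewrite -[(Posz m.+1)%:~R]pmulrn.
  have := slope_le slopeN (isT : 0 <= Posz m.+1).
  rewrite -[(Posz _)%:~R]pmulrn mul1r.
  rewrite (_ : Posz m.+1 + 1 = Posz m.+2); last by lia.
  move: IH; move: (N m.+1) (N m.+2).
  rewrite (_ : m.+1%:R = m%:R + 1 :> R); last by rewrite -addn1 natrD.
  move: (window N 0 m) (window (fun n => n%:~R ^+ 2 * N n) 0 m) => w v p q IH h.
  have m0 : 0 <= 2 * m%:R + 3 :> R by rewrite addr_ge0 ?mulr_ge0.
  have {}h : 2 * S * (p - q) <= (2 * m%:R + 3) * (p + q) by move: h; lra.
  have := ler_wpM2l m0 h; lra.
by have := H K; rewrite (NK K.+1) ?mulr0 ?subr0 ?addr0//; lia.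
Qed.

(** If S <= 16, then sqrt S <= 4 <= exp c and N 0 <= W suffice. Otherwise m, the integer part of
    sqrt S, is below S / 4, so N 0 <= exp (c m^2 / S) N m <= exp c N m, and [-m, m] holds 2 m + 1 >=
    sqrt S values that are at least N m. *)
Lemma slope_sup_bound c W : 3 <= c -> 0 < W ->
    (forall K, window N 0 K <= W) ->
  forall n, N n / W <= expR c / Num.sqrt S.
Proof.
move=> c3 W0 NW n.
have s0 : 0 < Num.sqrt S by rewrite sqrtr_gt0.
have sS : Num.sqrt S ^+ 2 = S by rewrite sqr_sqrtr ?ltW.
apply: (@le_trans _ _ (N 0 / W)).
  by rewrite ler_pM2r ?invr_gt0//; apply: (slope_radial slopeN); lia.
rewrite ler_pdivlMr// mulrAC ler_pdivrMr//.
have N0 := slope_ge0 slopeN 0.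
have [S16|S16] := leP S 16.
  have NW0 : N 0 <= W by have := NW 0%N; rewrite window0.
  have e4 : 4 <= expR c.
    by have := expR_ge1Dx c; lra.
  have s4 : Num.sqrt S <= 4.
    rewrite -(ler_pXn2r (n := 2))// ?nnegrE ?sqrtr_ge0// sS.
    by apply: (le_trans S16); rewrite expr2; lra.
  apply: (@le_trans _ _ (W * 4)); last by rewrite mulrC ler_wpM2r// ltW.
  by apply: ler_pM => //; exact: ltW.
pose m := Num.truncn (Num.sqrt S).
have /andP[ms sm] : m%:R <= Num.sqrt S < m.+1%:R by exact/truncn_itv/ltW.
have s4 : 4 < Num.sqrt S.
  by rewrite -(ltr_pXn2r (n := 2))// ?nnegrE ?sqrtr_ge0// sS expr2; lra.
have mS : m%:R < S / 4.
  apply: (le_lt_trans ms); rewrite ltr_pdivlMr// -[X in _ < X]sS expr2.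
  by rewrite ltr_pM2l.
apply: (@le_trans _ _ (expR c * window N 0 m)); last first.
  by rewrite ler_wpM2l ?NW// expR_ge0.
have h : N 0 <= expR c * N m.
  have := @slope_gaussian c 0 m ltac:(lra) ltac:(lia).
  rewrite -abszE -[(Posz _)%:~R]pmulrn => /(_ mS).
  rewrite {2}/gaussian_weight expr0n mulr0 mul0r oppr0 expR0 mul1r.
  rewrite /gaussian_weight expRN -ler_pdivlMl ?invr_gt0 ?expR_gt0// invrK.
  move=> /le_trans; apply; apply: ler_wpM2r; first exact: slope_ge0 slopeN _.
  rewrite ler_expR ler_pdivrMr// ler_wpM2l//; first by lra.
  by rewrite -[X in _ <= X]sS ler_pXn2r// nnegrE// ltW.
have hw : (2 * m%:R + 1) * N m <= window N 0 m.
  have := @window_le _ (fun x => - N x) 0 m (- N m).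
  rewrite /window sumrN mulrN lerN2; apply => x hx; rewrite lerN2.
  by apply: (slope_radial slopeN); lia.
apply: (@le_trans _ _ (N 0 * (2 * m%:R + 1))).
  apply: ler_wpM2l => //; apply: (le_trans (ltW sm)).
  by rewrite -addn1 natrD lerD2r; have : 0 <= m%:R :> R by []; lra.
apply: (@le_trans _ _ (expR c * N m * (2 * m%:R + 1))).
  by apply: ler_wpM2r => //; rewrite addr_ge0 ?mulr_ge0.
by rewrite -mulrA ler_wpM2l ?expR_ge0// mulrC.
Qed.

End GaussianComparison.

(** * The law at the root *)

Section UniformLaw.
Context d (S : measurableType d) (R : realType).
Variable A : set S.
Hypotheses (finA : finite_set A) (A0 : A !=set0).

Lemma card_fset_setI (B : set S) :
  #|` fset_set (B `&` A)|%:R = \sum_(x <- fset_set A) (x \in B)%:R :> R.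
Proof.
transitivity ((count (mem B) (fset_set A))%:R : R).
  congr (_%:R); rewrite -size_filter; apply: perm_size; apply: uniq_perm.
  - exact: fset_uniq.
  - by rewrite filter_uniq// fset_uniq.
  - move=> x; rewrite mem_filter !in_fset_set//; last exact: finite_setIr.
    by rewrite in_setI.
rewrite -sum1_count [in LHS]big_mkcond natr_sum; apply: eq_bigr => x _.
by rewrite /=; case: (x \in B).
Qed.

(** The uniform law is a sum of point masses 1 / n along an enumeration of A, and the integral
    splits accordingly. *)
Lemma integral_uniform_law (h : S -> R) : (forall x, 0 <= h x) ->
    measurable_fun [set: S] h ->
  (\int[uniform_law R A]_x (h x)%:E =
   ((\sum_(x <- fset_set A) h x) / #|` fset_set A|%:R)%:E)%E.
Proof.
move=> h0 mh; pose n := #|` fset_set A|.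
have n0 : 0 <= n%:R^-1 :> R by rewrite invr_ge0 ler0n.
pose m (k : nat) : {measure set S -> \bar R} :=
  mscale (NngNum n0) \d_(nth point (fset_set A) k).
have sumE (g : S -> R) : \sum_(x <- fset_set A) g x =
    \sum_(k < n) g (nth point (fset_set A) k).
  by rewrite (big_nth point) big_mkord.
have mE (B : set S) : uniform_law R A B = msum m n B.
  rewrite uniform_lawE// card_fset_setI sumE /msum mulr_suml -sumEFin.
  apply: eq_bigr => k _.
  transitivity ((n%:R^-1 : R)%:E * \d_(nth point (fset_set A) k) B)%E => //.
  by rewrite diracE -EFinM mulrC.
rewrite (eq_measure_integral (msum m n)); last by move=> B _ _; exact: mE.
have /measurable_EFinP mh' := mh.
rewrite ge0_integral_measure_sum//; last by move=> x _; rewrite lee_fin.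
rewrite sumE mulr_suml -sumEFin; apply: eq_bigr => k _.
rewrite ge0_integral_mscale//; last by move=> x _; rewrite lee_fin.
by rewrite integral_dirac// diracT mul1e mulrC EFinM.
Qed.

End UniformLaw.

Lemma esum_window (R : realType) (D : set int) (f : int -> R) (K : nat) :
    (forall x, 0 <= f x) -> (forall x, D x -> `|x| <= K%:Z) ->
  (\esum_(x in D) (f x)%:E = (window (fun x => (x \in D)%:R * f x) 0 K)%:E)%E.
Proof.
move=> f0 DK; pose Z := [seq 0 - K%:Z + k%:Z | k <- iota 0 K.*2.+1].
have DZ : D `<=` [set` Z].
  move=> x /DK xK; apply/mapP; exists (absz (x + K%:Z)); last lia.
  by rewrite mem_iota /=; lia.
have finD : finite_set D by apply: sub_finite_set DZ _.
rewrite (eq_esum (b := fun x => ((x \in D)%:R * f x)%:E)); last first.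
  by move=> x Dx; rewrite mem_set// mul1r.
rewrite esum_fset//; last by move=> x _; rewrite lee_fin mulr_ge0.
rewrite (fsbig_widen D [set` Z])//; last first.
  by move=> x [_ xD] /=; rewrite memNset// mul0r.
rewrite -fsbig_seq; last first.
  by rewrite map_inj_uniq ?iota_uniq// => i j; lia.
by rewrite sumEFin big_map /window -(big_mkord xpredT
  (fun k => (0 - K%:Z + k%:Z \in D)%:R * f (0 - K%:Z + k%:Z))) /index_iota subn0.
Qed.

Lemma law_proportional_to_window (R : realType) (D : set int)
    (w : int -> {nonneg R}) (B : set int) (K : nat) :
    (forall x, D x -> `|x| <= K%:Z) ->
    0 < window (fun x => (x \in D)%:R * (w x)%:num) 0 K ->
  law_proportional_to D w B =
  (window (fun x => (x \in B)%:R * ((x \in D)%:R * (w x)%:num)) 0 K /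
   window (fun x => (x \in D)%:R * (w x)%:num) 0 K)%:E.
Proof.
move=> DK W0; have E := @esum_window _ D (fun x => (w x)%:num) K _ DK.
rewrite law_proportional_toE; last by rewrite E// lte_fin W0 ltry.
rewrite E// (@esum_window _ (B `&` D) (fun x => (w x)%:num) K)//; last first.
  by move=> x [_ /DK].
rewrite -EFinM; congr ((_ / _)%:E); apply: eq_bigr => k _.
by rewrite in_setI; case: (_ \in B); rewrite /= ?mul1r ?mul0r.
Qed.

(** Split both totals by p: the products with both factors in p agree, and the mixed products
    compare term by term. *)
Lemma window_likelihood_ratio (R : realFieldType) (p : pred int)
    (f g : int -> R) (K : nat) :
    (forall x y, p x -> ~~ p y -> f x * g y <= g x * f y) ->
  window (fun x => (p x)%:R * f x) 0 K * window g 0 K <=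
  window (fun x => (p x)%:R * g x) 0 K * window f 0 K.
Proof.
move=> fg.
have split_window (h : int -> R) : window h 0 K = window (fun x => (p x)%:R * h x) 0 K +
    window (fun x => (~~ p x)%:R * h x) 0 K.
  rewrite /window -big_split; apply: eq_bigr => k _ /=.
  by case: (p _); rewrite /= mul1r mul0r ?addr0 ?add0r.
rewrite (split_window g) (split_window f) !mulrDr [X in X + _ <= _]mulrC lerD2l.
rewrite /window !big_distrlr; apply: ler_sum => i _; apply: ler_sum => j _ /=.
set x := 0 - _ + _; set y := 0 - _ + _.
case px: (p x); last by rewrite !mul0r.
case py: (p y); first by rewrite /= !mul0r !mulr0.
by rewrite /= !mul1r fg// py.
Qed.

Section RootLaw.
Variables (R : realType) (T : finType) (e : rel T) (r : T) (M : nat).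
Hypotheses (treeT : tree e).

Let A := lipschitz_vanishing_on e M (leaves e r).
Let N : int -> R := root_count R e r M.
Let P : probability {ffun T -> int} R := uniform_law R A.
Let W : R := #|` fset_set A|%:R.

Let finA : finite_set A. Proof. exact: finite_lipschitz. Qed.

Let zeroA : A [ffun=> 0].
Proof.
by split=> [u w _|x _]; rewrite !ffunE// subrr normr0.
Qed.

(** Group the functions by their value at r. Allowing every K beyond a threshold lets several sums
    share one window. *)
Lemma sum_root (h : int -> R) : exists K0 : nat, forall K, (K0 <= K)%N ->
  \sum_(phi <- fset_set A) h (phi r) = window (fun n => h n * N n) 0 K.
Proof.
exists (\max_(phi <- fset_set A) absz (phi r))%N => K K0K.
rewrite /window.
under [RHS]eq_bigr do rewrite /N /root_count (card_fset_setI R finA) mulr_sumr.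
rewrite exchange_big /=; apply: eq_big_seq => phi phiA.
have phiK : (absz (phi r) <= K)%N.
  by apply: leq_trans K0K; exact: leq_bigmax_seq.
have kK : (absz (phi r + K%:Z)%R < K.*2.+1)%N by lia.
rewrite (bigD1 (Ordinal kK)) //= big1 ?addr0.
  rewrite (_ : 0 - K%:Z + (absz (phi r + K%:Z))%:Z = phi r); last by lia.
  by rewrite mem_set// mulr1.
move=> i /eqP ik; rewrite memNset ?mulr0// => /= phii; apply: ik.
by apply: val_inj => /=; lia.
Qed.

Lemma root_total : exists K0 : nat, forall K, (K0 <= K)%N -> window N 0 K = W.
Proof.
have [K0 H] := sum_root (fun=> 1); exists K0 => K K0K.
transitivity (window (fun n => 1 * N n) 0 K).
  by apply: eq_bigr => k _; rewrite mul1r.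
by rewrite -H// big_const_seq count_predT iter_addr_0.
Qed.

Lemma root_total_gt0 : 0 < W.
Proof.
rewrite ltr0n cardfs_gt0; apply/fset0Pn; exists [ffun=> 0].
by rewrite in_fset_set// inE.
Qed.

Lemma root_law_eq (n : int) :
  P [set phi : {ffun T -> int} | phi r = n] = (N n / W)%:E.
Proof. by rewrite /P uniform_lawE//; exists [ffun=> 0]. Qed.

Lemma root_law_pred (p : pred int) : exists K0 : nat, forall K, (K0 <= K)%N ->
  P [set phi : {ffun T -> int} | p (phi r)] =
  (window (fun n => (p n)%:R * N n) 0 K / W)%:E.
Proof.
have [K0 H] := sum_root (fun n => (p n)%:R); exists K0 => K K0K.
rewrite /P uniform_lawE//; last by exists [ffun=> 0].
rewrite (card_fset_setI R finA) -H//; congr ((_ / _)%:E).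
apply: eq_bigr => phi _; congr (_%:R); congr nat_of_bool.
by apply/idP/idP => [|h]; rewrite inE.
Qed.

(** The mean c need not be computed: by symmetry (n - c)^2 may be averaged with (n + c)^2, which
    gives n^2 + c^2 >= n^2. *)
Lemma root_variance_ge : (forall n, N (- n) = N n) ->
  exists K0 : nat, forall K, (K0 <= K)%N ->
  ((window (fun n => n%:~R ^+ 2 * N n) 0 K / W)%:E
    <= 'V_P[fun phi : {ffun T -> int} => (phi r)%:~R])%E.
Proof.
move=> NN; rewrite /variance unlock unlock.
set c := fine _.
have [K0 H] := sum_root (fun n => (n%:~R - c) ^+ 2); exists K0 => K K0K.
rewrite (_ : (fun w => _) = (fun phi : {ffun T -> int} =>
    (((phi r)%:~R - c) ^+ 2)%:E)); last by apply/funext.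
rewrite integral_uniform_law//; last 2 first.
- by exists [ffun=> 0].
- by move=> phi; exact: sqr_ge0.
rewrite lee_fin (H K K0K) ler_pM2r ?invr_gt0 ?root_total_gt0//.
have E : window (fun n => (n%:~R - c) ^+ 2 * N n) 0 K =
         window (fun n => (n%:~R + c) ^+ 2 * N n) 0 K.
  rewrite -{1}oppr0 window_opp; apply: eq_bigr => k _.
  by rewrite NN mulrNz -opprD sqrrN.
suff : window (fun n => n%:~R ^+ 2 * N n) 0 K *+ 2 <=
       window (fun n => (n%:~R - c) ^+ 2 * N n) 0 K *+ 2.
  by rewrite lerMn2r.
rewrite !mulr2n {2}E /window -!big_split; apply: ler_sum => k _ /=.
rewrite -!mulrDl; apply: ler_wpM2r; first exact: ler0n.
have := sqr_ge0 c; set x := _%:~R; lra.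
Qed.

End RootLaw.

(** * The four estimates for the value at the root *)

Unset Implicit Arguments.
Set Strict Implicit.

Theorem corollary4p20 (R : realType) (T : finType) (e : rel T) (r : T)
    (M : nat) (treeT : tree e) (evenT : even_tree e r)
    (edgeT : exists x y, e x y) (M_gt0 : (0 < M)%N) :
  let P : probability {ffun T -> int} R :=
    uniform_law R (lipschitz_vanishing_on e M (leaves e r)) in
  let Reff : R := effective_resistance e R r (leaves e r) in
  let MR : R := M%:R in
  let I : set int := [set x : int | - (Reff / 4) < x%:~R < Reff / 4] in
  [/\ stochastically_dominates
        P (fun phi : {ffun T -> int} => `|phi r|%:~R)
        (discrete_gaussian I (Reff / (64 * MR + 32)))
        (fun x : int => `|x|%:~R),
      ((Num.floor (Reff / ((64 * MR + 32) * expR 4 * Num.sqrt pi)))%:~R%:E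
        <= 'V_P[fun phi : {ffun T -> int} => (phi r)%:~R])%E,
      forall n : int, - (Reff / 4) < n%:~R < Reff / 4 ->
        ((expR (- ((32 * MR + 16) * n%:~R ^+ 2 / Reff)))%:E
           * P [set phi : {ffun T -> int} | phi r = 0%R]
         <= P [set phi : {ffun T -> int} | phi r = n])%E
    & forall n : int,
        (P [set phi : {ffun T -> int} | phi r = n]
         <= (expR (32 * MR + 16) / Num.sqrt Reff)%:E)%E].
Proof.
move=> P S MR I.
have [S0 slopeN] : 0 < S /\ slope_bound S 1 (root_count R e r M).
  exact: slope_bound_root_count.
pose N := root_count R e r M; rewrite -/N in slopeN.
have W0 := root_total_gt0 R r M treeT.
have [Kt Ht] := root_total R r M treeT.
set W := (X in 0 < X) in W0; rewrite -/W -/N in Ht.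
have PE n : P [set phi : {ffun T -> int} | phi r = n] = (N n / W)%:E.
  exact: root_law_eq.
have MR0 : 0 <= MR by exact: ler0n.
(* Half of 64 M + 32, so that exp (- c x^2 / S) is the Gaussian weight of variance S / (64 M +
   32). *)
pose c : R := 32 * MR + 16.
have c3 : 3 <= c by rewrite /c; lra.
have c2 : 2 <= c by lra.
have N0 n : 0 <= N n := slope_ge0 slopeN n.
have II (n : int) : - (S / 4) < n%:~R < S / 4 -> `|n|%:~R < S / 4.
  by rewrite intr_norm ltr_norml.
split.
- move=> t; pose p (n : int) := t <= `|n|%:~R.
  have [Kp Hp] := root_law_pred R r M treeT p.
  pose K := maxn (maxn Kt Kp) (Num.truncn (S / 4)).
  have IK x : I x -> `|x| <= K%:Z.
    move=> /II xS.
    have h : `|x|%:~R < (Num.truncn (S / 4)).+1%:R :> R.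
      have S4 : 0 <= S / 4 by rewrite divr_ge0 ?ltW.
      by have /andP[_] := truncn_itv S4; exact: lt_trans.
    move: h; rewrite -abszE -[(Posz _)%:~R]pmulrn ltr_nat ltnS => h.
    by rewrite /K; lia.
  pose g x := (x \in I)%:R * gaussian_weight S c x%:~R.
  have g0 x : 0 <= g x by rewrite mulr_ge0// ltW// gaussian_weight_gt0.
  have gE x : (x \in I)%:R *
      expR (- (x%:~R ^+ 2 / (2 * (S / (64 * MR + 32))))) = g x.
    rewrite /g /gaussian_weight; congr (_ * expR _); rewrite /c; field.
    by rewrite !gt_eqF//; lra.
  have WgE : window g 0 K = window (fun x => (x \in I)%:R *
      expR (- (x%:~R ^+ 2 / (2 * (S / (64 * MR + 32)))))) 0 K.
    by apply: eq_bigr => k _; rewrite gE.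
  have Wg0 : 0 < window g 0 K.
    apply: (@lt_le_trans _ _ (window g 0 0)); last exact: window_mono.
    rewrite window0 /g mem_set ?mul1r ?gaussian_weight_gt0//.
    by rewrite /I /= oppr_lt0 divr_gt0.
  rewrite /discrete_gaussian (@law_proportional_to_window _ I _ _ K)//=.
    rewrite -WgE.
    rewrite (Hp K); last by rewrite /K; lia.
    rewrite lee_fin -/N -/W -(Ht K); last by rewrite /K; lia.
    have WN0 : 0 < window N 0 K by rewrite Ht// /K; lia.
    rewrite ler_pdivrMr// mulrAC ler_pdivlMr//.
    rewrite (_ : window (fun x => (x \in [set _ | _])%:R * _) 0 K =
      window (fun x => (p x)%:R * g x) 0 K); last first.
      apply: eq_bigr => k _; rewrite gE; congr (_ * _); congr (_%:R).
      by congr nat_of_bool; apply/idP/idP => [|h]; rewrite inE.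
    (* If t <= |x| but not t <= |y|, then |y| < |x|, so x in I forces y in I; for x outside I the
       left side is 0. *)
    apply: window_likelihood_ratio => x y px py; rewrite /g.
    have [xI|] := boolP (x \in I); last first.
      by rewrite !mul0r => _; apply: mulr_ge0; [exact: N0 | exact: g0].
    have xy : `|y| <= `|x|.
      by move: px py; rewrite /p -ltNge => h1 h2; rewrite -(ler_int R) ltW// (lt_le_trans h2).
    have xS := II x ltac:(by rewrite inE in xI).
    rewrite (_ : y \in I).
      by rewrite !mul1r [N x * _]mulrC; exact: slope_gaussian.
    by rewrite inE /I /= -ltr_norml -intr_norm (le_lt_trans _ xS)// ler_int.
  by rewrite -WgE.
- have [Kv Hv] := root_variance_ge treeT (slope_opp slopeN).
  pose K := maxn Kt Kv.
  (* The windows of radius m and m + 1 both have total W once m >= K, which leaves nothing at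
     distance m + 1. *)
  have NK (n : int) : K%:Z < `|n| -> N n = 0.
    rewrite (slope_abs slopeN); case: (absz n) (abszE n) => [<-|m <- Km].
      by rewrite ltNge.
    have := Ht m.+1; have := Ht m; rewrite windowS !add0r.
    rewrite (slope_opp slopeN) => -> //; last by rewrite /K in Km; lia.
    move=> /(_ ltac:(rewrite /K in Km; lia)); have := N0 m.+1; lra.
  apply: le_trans (Hv K _); last by rewrite /K; lia.
  have := slope_second_moment S0 slopeN NK.
  rewrite Ht ?leq_maxl//; set V := window _ _ _ => hV.
  have V0 : 0 <= V by apply: sumr_ge0 => i _; rewrite mulr_ge0 ?sqr_ge0.
  rewrite lee_fin -/N -/W -/V.
  have {}hV : S / 2 - 1 / 4 <= V / W by rewrite ler_pdivlMr//; lra.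
  set D := (_ * _ * _ : R).
  have D4 : 4 <= D.
    have e1 : 1 <= expR 4 :> R by rewrite -expR0 ler_expR.
    have p1 : 1 <= Num.sqrt pi :> R.
      by rewrite -sqrtr1 ler_sqrt ?pi_gt0//; have := pi_ge2 R; lra.
    have m1 : 4 <= 64 * MR + 32 by lra.
    rewrite -[4 in X in X <= _]mulr1 -[4 * 1 in X in X <= _]mulr1.
    by rewrite !ler_pM// ?mulr_ge0 ?expR_ge0//; lra.
  (* A floor at most 0 makes the bound trivial. Otherwise S >= D >= 4, hence S / D <= S / 4 <= S / 2
     - 1 / 4. *)
  have [fl0|fl1] := lerP (Num.floor (S / D)) 0.
    apply: (@le_trans _ _ 0); first by rewrite lerz0.
    by rewrite divr_ge0// ltW.
  have D0 : 0 < D by lra.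
  have h1 : 1 <= S / D.
    by apply: le_trans (floor_le _); rewrite ler1z -gtz0_ge1.
  apply: (le_trans (floor_le _)); apply: le_trans hV.
  have SD : D <= S by move: h1; rewrite ler_pdivlMr// mul1r.
  apply: (@le_trans _ _ (S / 4)); last by lra.
  by rewrite ler_pM2l// lef_pV2// posrE.
- move=> n /II nS; rewrite !PE -EFinM lee_fin mulrA ler_pM2r ?invr_gt0//.
  (* Compare with the value 0, where the Gaussian weight is 1. *)
  have := slope_gaussian S0 slopeN c2 (_ : `|0| <= `|n|) nS.
  rewrite normr0 normr_ge0 => /(_ isT).
  by rewrite /gaussian_weight expr0n mulr0 mul0r oppr0 expR0 mul1r.
- move=> n; rewrite PE lee_fin; apply: slope_sup_bound => // K.
  have [KK|KK] := leqP K Kt; first by rewrite -(Ht Kt)// window_mono.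
  by rewrite Ht// ltnW.
Qed.
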